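(* For every continuous $c:\mathcal{N}\to[0;1]$ there is a continuous function $\mathcal{F}_c:\mathrm{PrTr}_2\to\mathbf{K}$ such that for every $T\in\mathrm{PrTr}_2$, the compact set $\mathcal{F}_c(T)$ is the closed offspring of $T$ determined by some compliant family $(D_t)_{t\in T}$, and for every $x\in[T]$ one has $x\in\mathcal{N}\iff\mathcal{O}_{\mathcal{F}_c(T)}(\overline{x})=0$; moreover for $x\in[T]\cap\mathcal{N}$, $\mathcal{D}_{\mathcal{F}_c(T)}(\overline{x})=c(x)$.
   Context: $2^{\omega}$ is the Cantor space; $N_s=\{x\in2^\omega:s\subset x\}$; $\mu$ is the coin-tossing measure, $\mu(N_s)=2^{-\mathrm{lh}(s)}$. For measurable $A$, $\mathcal{D}_A(z)=\lim_n\mu(A\cap N_{z\restriction n})/\mu(N_{z\restriction n})$ when it exists, and $\mathcal{O}_A(z)=\limsup_n-\liminf_n$ of those ratios (the oscillation). $A$ is dualistic if $\mathcal{D}_A(z)$ exists and lies in $\{0,1\}$ for all $z$. $\mathcal{N}=\{y\in2^\omega:y(n)=1\text{ for infinitely many }n\}$. $\mathrm{PrTr}_2$ is the set of pruned trees on $\{0,1\}$ (nonempty sets of finite binary sequences closed under initial segments, every node having a proper extension), viewed as a subspace of $2^{(2^{<\omega})}\cong2^\omega$ (a $G_\delta$, hence Polish); $[T]$ is the set of branches. $\mathbf{K}$ is the Polish space of compact subsets of $2^\omega$ with the Vietoris topology. The stretch of $s\in2^{\le\omega}$ is $\overline{s}=s(0)^{(1)}{}^\frown s(1)^{(2)}{}^\frown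 s(2)^{(3)}\cdots$ ($s(j)$ repeated $j+1$ times). $\mathrm{Fl}(n)=2^{n+1}\setminus\{0^{(n+1)},1^{(n+1)}\}$. A family $(D_t)_{t\in T}$ is compliant if each $D_t$ is dualistic, $\emptyset\ne D_t\ne2^\omega$, and $\mu(\operatorname{Int}D_t)=\mu(\operatorname{Cl}D_t)$; its closed offspring is $\overline{[T]}\cup\bigcup\{\overline{t}^\frown a^\frown\operatorname{Cl}D_t:t\in T,\ a\in\mathrm{Fl}(\mathrm{lh}\,t)\}$, where $\overline{[T]}=\{\overline{x}:x\in[T]\}$. *)

(* Defs.v *)
From HB Require Import structures.
From mathcomp Require Import all_boot all_order all_algebra.
From mathcomp Require Import all_classical all_reals.
From mathcomp Require Import ereal topology normedtype sequences cantor.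
Set Implicit Arguments. Unset Strict Implicit. Unset Printing Implicit Defensive.
Import Order.TTheory GRing.Theory Num.Theory.
Import numFieldNormedType.Exports.
Local Open Scope classical_set_scope.
Local Open Scope ring_scope.

Notation cantor := cantor_space.

Definition restr (x : cantor) (n : nat) : seq bool := mkseq x n.

Definition Nbas (s : seq bool) : set cantor :=
  [set x | restr x (size s) = s].

Definition catinf (s : seq bool) (w : cantor) : cantor :=
  fun k => if (k < size s)%N then nth false s k else w (k - size s)%N.

Section Measure.
Variable R : realType.
Local Open Scope ereal_scope.

(* coin-tossing (outer) measure: mu*(A) = inf of sum 2^-lh(s_i) over
   countable covers of A by basic open sets N_{s_i}; on mu-measurable sets
   this is the coin-tossing measure mu. *)
Definition mu (A : set cantor) : \bar R :=
  ereal_inf [set \sum_(i <oo) (((2%:R : R) ^- size (s i))%:E) | s in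
              [set s : nat -> seq bool | A `<=` \bigcup_i Nbas (s i)]].

Definition mu_measurable (A : set cantor) : Prop :=
  forall X : set cantor, mu X = mu (X `&` A) + mu (X `&` ~` A).
End Measure.

Section Density.
Variable R : realType.

Definition dratio (A : set cantor) (z : cantor) : R^o^nat :=
  fun n => fine (mu R (A `&` Nbas (restr z n))) / fine (mu R (Nbas (restr z n))).

Definition density_is (A : set cantor) (z : cantor) (d : R) : Prop :=
  dratio A z @ \oo --> d.

Definition oscillation (A : set cantor) (z : cantor) : R :=
  limn_sup (dratio A z) - limn_inf (dratio A z).

Definition dualistic (A : set cantor) : Prop :=
  mu_measurable R A /\
  forall z, density_is A z 0 \/ density_is A z 1.
End Density.

Definition Ninf : set cantor := [set y | forall m, exists2 n, (m <= n)%N & y n].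

Definition pruned_tree (T : set (seq bool)) : Prop :=
  [/\ T !=set0,
      (forall t n, T t -> T (take n t)) &
      (forall t, T t -> exists2 u, T u & (size t < size u)%N /\ take (size t) u = t)].

Definition branches (T : set (seq bool)) : set cantor :=
  [set x | forall n, T (restr x n)].

Definition stretch (s : seq bool) : seq bool :=
  flatten [seq nseq j.+1 (nth false s j) | j <- iota 0 (size s)].

Definition stretch_inf (x : cantor) : cantor :=
  fun k => nth false (stretch (restr x k.+1)) k.

Definition Fl (n : nat) : set (seq bool) :=
  [set a | size a = n.+1 /\ a <> nseq n.+1 false /\ a <> nseq n.+1 true].

Section Offspring.
Variable R : realType.

Definition compliant (T : set (seq bool)) (D : seq bool -> set cantor) : Prop :=
  forall t, T t ->
    [/\ dualistic R (D t), D t <> set0, D t <> setT &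
        mu R (interior (D t)) = mu R (closure (D t))].
End Offspring.

Definition closed_offspring (T : set (seq bool)) (D : seq bool -> set cantor)
  : set cantor :=
  (stretch_inf @` branches T) `|`
  [set y | exists t a w, [/\ T t, Fl (size t) a, closure (D t) w &
                             y = catinf (stretch t ++ a) w]].

Definition vietoris_subbasic (V : set (set cantor) ) : Prop :=
  exists2 U : set cantor, open U &
    (V = [set K | K `<=` U] \/ V = [set K | K `&` U !=set0]).

(* continuity of F : PrTr_2 -> K, PrTr_2 carrying the subspace topology of
   the product 2^(2^{<omega}) (basic neighbourhoods: agreement on a finite
   set of nodes), K carrying the Vietoris topology (via its subbasis). *)
Definition continuous_PrTr_K (F : set (seq bool) -> set cantor) : Prop :=
  forall T, pruned_tree T -> forall V, vietoris_subbasic V -> V (F T) ->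
    exists L : seq (seq bool), forall T', pruned_tree T' ->
      (forall s, s \in L -> (T s <-> T' s)) -> V (F T').

(* Main.v *)
(** Every piece [D_t] is clopen and depends only on [t] and [c], not on the tree, so
    the closed offspring is continuous in the tree.  Between consecutive nodes of
    a stretched branch the relative measure of the offspring interpolates
    geometrically, and along the branch it is asymptotic to the measure [g t] of
    [D_t], for [t] the initial segments of the branch [x].  Hence one only needs dyadic
    [0 < g t < 1] that converge to [c x] if [x] has infinitely many ones and
    oscillate otherwise.  With [m] the length of [t] up to its last one, let [g t]
    be an approximation of [c] at the point [(take m t)11...] within [2^-m], in
    which one adds [2^-(m+2)] exactly when [t] has odd length: [m] tends to infinity
    in the first case and is eventually constant in the second. *)

Require Import Defs.
From HB Require Import structures.
From mathcomp Require Import all_boot all_order all_algebra.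
From mathcomp Require Import all_classical all_reals.
From mathcomp Require Import ereal topology normedtype sequences cantor.
From mathcomp Require Import ring lra.
Set Implicit Arguments.
Unset Strict Implicit.
Unset Printing Implicit Defensive.
Import Order.TTheory GRing.Theory Num.Theory.
Import numFieldNormedType.Exports.
Local Open Scope classical_set_scope.
Local Open Scope ring_scope.

(** * The coin-tossing measure *)

Lemma size_restr (x : cantor) n : size (restr x n) = n.
Proof. exact: size_mkseq. Qed.

Lemma nth_restr (x : cantor) n i : (i < n)%N -> nth false (restr x n) i = x i.
Proof. by move=> ilt; rewrite nth_mkseq. Qed.

Lemma restrS (x : cantor) n : restr x n.+1 = rcons (restr x n) (x n).
Proof. exact: mkseqS. Qed.

Lemma take_restr (x : cantor) n m : (n <= m)%N -> take n (restr x m) = restr x n.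
Proof. by move=> nm; rewrite /restr /mkseq -map_take take_iota (minn_idPl nm). Qed.

Lemma restrP (x y : cantor) n :
  restr x n = restr y n <-> forall i, (i < n)%N -> x i = y i.
Proof.
split=> [e i ilt|e]; first by rewrite -(nth_restr x ilt) e nth_restr.
by apply: (@eq_from_nth _ false) => [|i]; rewrite !size_restr // => ilt;
  rewrite !nth_restr ?e.
Qed.

Lemma restr_le (x y : cantor) n m :
  (n <= m)%N -> restr x m = restr y m -> restr x n = restr y n.
Proof. by move=> nm e; rewrite -(take_restr x nm) e take_restr. Qed.

Lemma Nbas_prefix (u s : seq bool) (x : cantor) :
  prefix u s -> Nbas s x -> Nbas u x.
Proof.
move=> /prefixP[t ->]; rewrite /Nbas /= size_cat => e.
by rewrite -(take_restr _ (leq_addr (size t) _)) e take_size_cat.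
Qed.

Lemma Nbas_comparable (u s : seq bool) (x : cantor) :
  (size u <= size s)%N -> Nbas u x -> Nbas s x -> prefix u s.
Proof.
by rewrite /Nbas /= => us eu es; rewrite prefixE -es take_restr// eu.
Qed.

Lemma Nbas_rcons (u : seq bool) b (x : cantor) :
  Nbas (rcons u b) x <-> Nbas u x /\ x (size u) = b.
Proof.
rewrite /Nbas /= size_rcons restrS; split=> [/rcons_inj[-> ->]//|[-> ->]//].
Qed.

Lemma Nbas_catP (v s : seq bool) (y : cantor) :
  Nbas (v ++ s) y <-> Nbas v y /\ restr (fun k => y (size v + k)%N) (size s) = s.
Proof.
rewrite /Nbas /= size_cat /restr /mkseq iotaD map_cat add0n -{2}[size v]addn0.
rewrite iotaDl -map_comp; split=> [/eqP|[-> e]].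
  by rewrite eqseq_cat ?size_map ?size_iota// => /andP[/eqP-> /eqP].
by congr cat; rewrite -[RHS]e.
Qed.

Section CoinTossing.
Variable R : realType.
Local Open Scope ereal_scope.
Implicit Types (A X : set cantor) (u v : seq bool).

(** [None] is an absent member of weight zero: covers built by selecting members of another cover
    then keep its indexing. *)
Definition cost (o : option (seq bool)) : R :=
  if o is Some u then (2 ^- size u)%R else 0%R.

Lemma cost_ge0 o : (0 <= cost o)%R.
Proof. by case: o => //= u; rewrite invr_ge0 exprn_ge0. Qed.

Lemma mu_ge0 A : 0 <= mu R A.
Proof.
apply/ereal_infP => _ [s _ <-]; apply: nneseries_ge0 => n _ _.
by rewrite lee_fin invr_ge0 exprn_ge0.
Qed.

Lemma half_expn_lt (e : R) : (0 < e)%R -> exists K, (2 ^- K < e)%R.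
Proof.
move=> e0; have [K _ KP] := near_infty_natSinv_expn_lt (PosNum e0).
by exists K; have := KP K (leqnn _); rewrite /= div1r.
Qed.

Lemma mu_le_cover A (s : nat -> option (seq bool)) :
  (forall x, A x -> exists i u, s i = Some u /\ Nbas u x) ->
  mu R A <= \sum_(i <oo) (cost (s i))%:E.
Proof.
move=> cov; apply/lee_addgt0Pr => e e0; have [K Ke] := half_expn_lt e0.
apply: le_trans (epsilon_trick xpredT _ (ltW e0)); last first.
  by move=> n; rewrite lee_fin cost_ge0.
(* Absent members are replaced by nodes of weight [2 ^- (K + i.+1)], which is at most [e / 2 ^ i.+1]
   since [2 ^- K < e]; these fillers add at most [e] altogether. *)
pose s' i := if s i is Some u then u else nseq (K + i.+1) false.
apply: ge_ereal_inf; exists (\sum_(i <oo) (((2%:R : R) ^- size (s' i))%:E)).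
  exists s' => // x /cov[i [u [si ux]]]; exists i => //.
  by rewrite /s' si.
apply: lee_nneseries => [i _ _|i _]; first by rewrite lee_fin invr_ge0 exprn_ge0.
rewrite /s' -EFinD lee_fin /cost; case: (s i) => [u|].
  by rewrite lerDl divr_ge0// ltW.
rewrite size_nseq add0r exprD invfM natrX ler_pM// ?invr_ge0 ?exprn_ge0//.
exact: ltW.
Qed.

Lemma le_mu A X : A `<=` X -> mu R A <= mu R X.
Proof.
move=> AX; apply: ereal_inf_le_tmp => _ [s cov <-]; exists s => //.
exact: subset_trans cov.
Qed.

Lemma mu_set0 : mu R set0 = 0.
Proof.
apply/eqP; rewrite eq_le mu_ge0 andbT.
by apply: (le_trans (@mu_le_cover _ (fun=> None) _)) => //; rewrite eseries0.
Qed.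

Lemma mu_Nbas_le u : mu R (Nbas u) <= ((2 ^- size u)%R)%:E.
Proof.
apply: (le_trans (@mu_le_cover _ (fun i => if i == 0%N then Some u else None) _)).
  by move=> x ux; exists 0%N, u.
rewrite (nneseries_split 0 1) => [|k _]; last by rewrite lee_fin cost_ge0.
rewrite big_nat1 /= eseries0 ?adde0// => i; rewrite add0n.
by case: i.
Qed.

Lemma muU_le A X : mu R (A `|` X) <= mu R A + mu R X.
Proof.
apply/lee_addgt0Pr => e e0.
have [->|Afin] := eqVneq (mu R A) +oo.
  by rewrite addye ?leey// gt_eqF// (lt_le_trans _ (mu_ge0 X)).
have [->|Xfin] := eqVneq (mu R X) +oo.
  by rewrite addey ?leey// gt_eqF// (lt_le_trans _ (mu_ge0 A)).
have e2 : (0 < e / 2)%R by rewrite divr_gt0.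
have fin B : mu R B != +oo -> mu R B \is a fin_num.
  by move=> h; rewrite ge0_fin_numE ?mu_ge0// ltey.
have [_ [a acov <-] aA] := lb_ereal_inf_adherent e2 (fin _ Afin).
have [_ [b bcov <-] bX] := lb_ereal_inf_adherent e2 (fin _ Xfin).
have -> : mu R A + mu R X + e%:E =
    (mu R A + (e / 2)%:E) + (mu R X + (e / 2)%:E).
  by rewrite addeACA -EFinD -splitr.
(* The two covers are interleaved on even and odd indices, so that the first [n.*2] terms consist of
   [n] terms of each. *)
pose s i := Some (if odd i then b i./2 else a i./2).
apply: le_trans (leeD (ltW aA) (ltW bX)).
apply: (le_trans (@mu_le_cover _ s _)) => [x [/acov|/bcov] [i _ xi]|].
- by exists i.*2, (a i); rewrite /s odd_double doubleK.
- by exists i.*2.+1, (b i); rewrite /s /= odd_double uphalf_double.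
apply: lime_le; first by apply: is_cvg_nneseries => n _ _; rewrite lee_fin cost_ge0.
have pos (f : nat -> seq bool) i : 0 <= ((2 ^- size (f i))%R : R)%:E.
  by rewrite lee_fin invr_ge0 exprn_ge0.
near=> n.
apply: (@le_trans _ _ (\sum_(0 <= i < n.*2) (cost (s i))%:E)).
  rewrite (@big_cat_nat _ _ _ n 0 n.*2)//= -?addnn ?leq_addr//.
  by rewrite leeDl// sume_ge0// => i _; rewrite lee_fin cost_ge0.
have -> : \sum_(0 <= i < n.*2) (cost (s i))%:E =
   \sum_(0 <= i < n) ((2 ^- size (a i))%R)%:E + \sum_(0 <= i < n) ((2 ^- size (b i))%R)%:E.
  elim: (n) => [|k IH]; first by rewrite !big_nil adde0.
  rewrite doubleS !big_nat_recr//= IH /s /= odd_double/= doubleK uphalf_double.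
  by rewrite -addeA [RHS]addeACA.
by apply: leeD; apply: nneseries_lim_ge => i _ _; exact: pos.
Unshelve. all: by end_near. Qed.

Lemma half_expn n : (2 ^- n = 2 ^- n.+1 + 2 ^- n.+1 :> R)%R.
Proof. by rewrite exprS invfM; lra. Qed.

Lemma mu_split A u :
  mu R (A `&` Nbas u) =
  mu R (A `&` Nbas (rcons u false)) + mu R (A `&` Nbas (rcons u true)).
Proof.
apply/eqP; rewrite eq_le; apply/andP; split.
  apply: le_trans (muU_le _ _); apply: le_mu => x [Ax ux].
  by case xu: (x (size u)); [right|left]; split=> //; apply/Nbas_rcons.
apply/ereal_infP => _ [s cov <-].
(* A cover of the piece in [Nbas u] is distributed over the children: a member extending a child
   goes to that child, a member containing [Nbas u] is cut down to each child, any other is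
   dropped. *)
pose part b i := let v := rcons u b in
  if prefix v (s i) then Some (s i) else if prefix (s i) u then Some v else None.
have partP b : mu R (A `&` Nbas (rcons u b)) <= \sum_(i <oo) (cost (part b i))%:E.
  apply: mu_le_cover => x [Ax vx].
  have ux : Nbas u x by case/Nbas_rcons: vx.
  have [i _ xi] := cov x (conj Ax ux); exists i; rewrite /part.
  have [sv|vs] := leqP (size (rcons u b)) (size (s i)).
    by exists (s i); rewrite (Nbas_comparable sv vx xi).
  case: ifP => _; first by exists (s i).
  rewrite size_rcons ltnS in vs; rewrite (Nbas_comparable vs xi ux).
  by exists (rcons u b).
apply: le_trans (leeD (partP false) (partP true)) _.
rewrite -nneseriesD => [|i _ _|i _ _]; rewrite ?lee_fin ?cost_ge0//.
apply: lee_nneseries => i _; rewrite -EFinD lee_fin ?addr_ge0 ?cost_ge0//.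
have pos n : (0 <= 2 ^- n :> R)%R by rewrite invr_ge0 exprn_ge0.
(* A member containing [Nbas u] weighs at least [2 ^- size u], which pays for both children; any
   other member is kept by at most one child. *)
rewrite /part; have [siu|nsiu] := boolP (prefix (s i) u).
  have nb b : prefix (rcons u b) (s i) = false.
    apply/negP => /prefix_trans /(_ siu) /size_prefix.
    by rewrite size_rcons ltnn.
  rewrite !nb /= !size_rcons; have {nb} /size_prefix le := siu.
  apply: (@le_trans _ _ (2 ^- size u)%R); last first.
    by rewrite lef_pV2 ?posrE ?exprn_gt0// ler_eXn2l// ltr1n.
  by rewrite -half_expn.
have [/prefixP[t e]|_] := boolP (prefix (rcons u false) (s i)).
  case: (boolP (prefix (rcons u true) (s i))) => [/prefixP[t' e']|_]; last by rewrite /= addr0.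
  by have := e; rewrite e' !cat_rcons => /eqP; rewrite eqseq_cat// eqxx.
by rewrite add0r; case: ifP => //=.
Qed.


(* Given a cover of total weight less than 1, choose greedily a branch along
   which the weight of the members of the cover extending the current node stays less
   than the measure of the node: no member of the cover contains that branch. *)
Lemma mu_setT_ge1 : 1 <= mu R setT.
Proof.
apply/ereal_infP => _ [s cov <-]; rewrite leNgt; apply/negP => lt1.
pose w u := \sum_(i <oo) (if prefix u (s i) then ((2 ^- size (s i))%R : R)%:E else 0).
have pos n : 0 <= ((2 ^- n)%R : R)%:E by rewrite lee_fin invr_ge0 exprn_ge0.
have posw u i : 0 <= (if prefix u (s i) then ((2 ^- size (s i))%R : R)%:E else 0).
  by case: ifP.
have w_split u : w (rcons u false) + w (rcons u true) <= w u.
  rewrite -nneseriesD => [|i _ _|i _ _]; rewrite ?posw//.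
  apply: lee_nneseries => i _; rewrite ?adde_ge0//.
  have sub b : prefix (rcons u b) (s i) -> prefix u (s i).
    by apply: prefix_trans; exact: prefix_rcons.
  case: ifP => h0; last by case: ifP => h1; rewrite add0e// (sub _ h1).
  rewrite (sub _ h0); case: ifP => h1; last by rewrite adde0.
  case/prefixP: h0 => t e; case/prefixP: h1 => t'.
  by rewrite e !cat_rcons => /eqP; rewrite eqseq_cat// eqxx.
pose step u := ~~ (w (rcons u false) < ((2 ^- (size u).+1)%R : R)%:E).
have stepP u : w u < ((2 ^- size u)%R : R)%:E ->
    w (rcons u (step u)) < ((2 ^- (size u).+1)%R : R)%:E.
  move=> lt; rewrite /step; case: (boolP (w (rcons u false) < _)) => //=.
  rewrite -leNgt => h0; rewrite ltNge; apply/negP => h1.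
  have := lt_le_trans lt (le_trans _ (w_split u)).
  rewrite half_expn EFinD => /(_ (leeD h0 h1)); by rewrite ltxx.
pose pre := fix pre n := if n is k.+1 then rcons (pre k) (step (pre k)) else [::].
have size_pre n : size (pre n) = n by elim: n => //= n IH; rewrite size_rcons IH.
pose x : cantor := fun n => step (pre n).
have xpre n : restr x n = pre n by elim: n => // n IH; rewrite restrS IH.
have wx n : w (pre n) < ((2 ^- n)%R : R)%:E.
  elim: n => [|n IH]; last by have := stepP (pre n); rewrite size_pre => /(_ IH).
  by rewrite /w /= expr0 invr1; under eq_eseriesr do rewrite prefix0s.
have [i _ xi] := cov x I; have := wx (size (s i)); rewrite -xpre xi.
rewrite ltNge => /negP; apply.
apply: le_trans (nneseries_lim_ge i.+1 _); last by move=> n _ _; exact: posw.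
by rewrite big_nat_recr//= prefix_refl leeDr// sume_ge0.
Qed.

(** By induction the two children of [u] have total measure [2 ^- size u], and the upper bound gives
    each at most half of it, so both bounds are attained. *)
Lemma mu_Nbas u : mu R (Nbas u) = ((2 ^- size u)%R)%:E.
Proof.
elim/last_ind: u => [|u b IH].
  apply/eqP; rewrite eq_le mu_Nbas_le /= expr0 invr1.
  by apply: le_trans mu_setT_ge1 _; exact: le_mu.
apply/eqP; rewrite eq_le mu_Nbas_le /=.
have := mu_split setT u; rewrite !setTI IH half_expn EFinD.
have fin v : mu R (Nbas v) \is a fin_num.
  by rewrite ge0_fin_numE ?mu_ge0// (le_lt_trans (mu_Nbas_le _))// ltry.
have := mu_Nbas_le (rcons u false); have := mu_Nbas_le (rcons u true).
rewrite !size_rcons -(fineK (fin (rcons u false))) -(fineK (fin (rcons u true))).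
rewrite -!EFinD !lee_fin => le1 le0 [e].
by case: b; rewrite -(fineK (fin _)) lee_fin; lra.
Qed.

Lemma mu_fin A : mu R A \is a fin_num.
Proof.
rewrite ge0_fin_numE ?mu_ge0//; apply: (@le_lt_trans _ _ (mu R (Nbas [::]))).
  exact: le_mu.
by rewrite mu_Nbas ltry.
Qed.

(** * Relative measures, and sets determined by finitely many coordinates *)

Local Open Scope ring_scope.

(* The relative measure of [A] in [Nbas u]. *)
Definition rho A u : R := 2 ^+ size u * fine (mu R (A `&` Nbas u)).

Lemma dratioE A z n : dratio R A z n = rho A (restr z n).
Proof.
by rewrite /dratio /rho mu_Nbas /= invrK mulrC.
Qed.

Lemma rho_ge0 A u : 0 <= rho A u.
Proof. by apply: mulr_ge0; [rewrite exprn_ge0 | rewrite fine_ge0// mu_ge0]. Qed.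

Lemma rho_le1 A u : rho A u <= 1.
Proof.
rewrite /rho mulrC -ler_pdivlMr ?exprn_gt0// div1r.
by rewrite -lee_fin fineK ?mu_fin// -mu_Nbas; apply: le_mu; exact: subIsetr.
Qed.

(** The martingale identity of relative measures; later computations run it backwards, from children
    to parent. *)
Lemma rho_split A u : rho A u = (rho A (rcons u false) + rho A (rcons u true)) / 2.
Proof.
rewrite /rho mu_split fineD ?mu_fin// !size_rcons exprS.
by field.
Qed.

Lemma rho1 A u : Nbas u `<=` A -> rho A u = 1.
Proof.
move=> uA; rewrite /rho (setIidr uA) mu_Nbas /= divff// expf_neq0//.
Qed.

Lemma rho0 A u : A `&` Nbas u = set0 -> rho A u = 0.
Proof. by rewrite /rho => ->; rewrite mu_set0 /= mulr0. Qed.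

Fixpoint words n : seq (seq bool) :=
  if n is m.+1 then [seq rcons u b | u <- words m, b <- [:: false; true]]
  else [:: [::]].

Lemma mem_words n s : (s \in words n) = (size s == n).
Proof.
elim: n s => [|n IH] s; first by rewrite inE size_eq0.
apply/allpairsP/idP => [[[u b] /= [uw _ ->]]|].
  by rewrite size_rcons eqSS -IH.
case/lastP: s => // s b; rewrite size_rcons eqSS -IH => sw.
by exists (s, b); split=> //; case: b.
Qed.

Lemma uniq_words n : uniq (words n).
Proof.
elim: n => // n IH; apply: (@allpairs_uniq _ _ _ rcons) => // -[u b] [v d] _ _ /= e.
by have [-> ->] := rcons_inj e.
Qed.

Lemma size_words n : size (words n) = (2 ^ n)%N.
Proof. by elim: n => // n IH; rewrite [LHS]size_allpairs IH expnSr. Qed.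

Lemma big_wordsS (V : nmodType) n (F : seq bool -> V) :
  \sum_(s <- words n.+1) F s =
  \sum_(s <- words n) (F (rcons s false) + F (rcons s true)).
Proof.
rewrite [LHS]big_allpairs_dep; apply: eq_bigr => s _.
by rewrite big_cons big_seq1.
Qed.

Lemma mu_words A n v :
  mu R (A `&` Nbas v) = (\sum_(s <- words n) mu R (A `&` Nbas (v ++ s)))%E.
Proof.
elim: n => [|n IH]; first by rewrite big_seq1 cats0.
rewrite big_wordsS IH; apply: eq_bigr => s _.
by rewrite mu_split -!rcons_cat.
Qed.

Lemma rho_words A n v : rho A v = (\sum_(s <- words n) rho A (v ++ s)) / 2 ^+ n.
Proof.
elim: n => [|n IH]; first by rewrite big_seq1 cats0 expr0 divr1.
rewrite IH big_wordsS exprS invfM mulrA; congr (_ / _).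
rewrite mulr_suml; apply: eq_bigr => s _.
by rewrite -!rcons_cat rho_split.
Qed.

(** A clopen set with an explicit modulus: [A] is a union of cylinders of length [n], so its measure
    can be found by counting words. *)
Definition determined n A := forall x y, restr x n = restr y n -> A x -> A y.

Lemma determinedC n A : determined n A -> determined n (~` A).
Proof. by move=> dA x y e nA Ay; apply: nA; apply: dA Ay. Qed.

(** Each cylinder of length [n] lies in [A] or misses it, so on each of them one of the two summands
    vanishes. *)
Lemma determined_mu_measurable n A : determined n A -> mu_measurable R A.
Proof.
move=> dA X; have X0 Y : mu R Y = (\sum_(s <- words n) mu R (Y `&` Nbas s))%E.
  by rewrite -(mu_words Y n [::]) ; congr mu; apply/seteqP; split=> x //= [].
rewrite (X0 X) (X0 (X `&` A)) (X0 (X `&` ~` A)) -big_split /= big_seq [RHS]big_seq.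
apply: eq_bigr => s; rewrite mem_words => /eqP sn.
have [[x [sx Ax]]|nA] := pselect (exists x, Nbas s x /\ A x).
  have -> : X `&` ~` A `&` Nbas s = set0.
    apply/seteqP; split=> y //= [[_ nA] sy]; apply: nA; apply: dA Ax.
    by rewrite -sn sx sy.
  rewrite mu_set0 adde0; congr mu; apply/seteqP; split=> y /=; last by move=> [[]].
  by move=> [Xy sy]; split=> //; split=> //; apply: dA Ax; rewrite -sn sx sy.
have -> : X `&` A `&` Nbas s = set0.
  by apply/seteqP; split=> y //= [[_ Ay] sy]; apply: nA; exists y.
rewrite mu_set0 add0e; congr mu; apply/seteqP; split=> y /=; last by move=> [[]].
by move=> [Xy sy]; split=> //; split=> // Ay; apply: nA; exists y.
Qed.

Lemma determined_dualistic n A : determined n A -> dualistic R A.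
Proof.
move=> dA; split; first exact: determined_mu_measurable dA.
move=> z; have [Az|nAz] := pselect (A z); [right|left]; apply: cvg_near_cst.
all: near=> m; rewrite dratioE.
all: have nm : (n <= m)%N by near: m; exact: nbhs_infty_ge.
- apply: rho1 => x; rewrite /Nbas /= size_restr => /esym e.
  exact: dA (restr_le nm e) Az.
- apply: rho0; apply/seteqP; split=> x //= [Ax]; rewrite /Nbas /= size_restr => e.
  exact: nAz (dA _ _ (restr_le nm e) Ax).
Unshelve. all: by end_near. Qed.

End CoinTossing.

(** * Topology of the Cantor space *)

Lemma nbhs_cantorP (x : cantor) (A : set cantor) :
  nbhs x A <-> exists n, forall y : cantor, restr x n = restr y n -> A y.
Proof.
split.
  (* The sets containing a cylinder around [x] form a filter; it converges to [x] because it does so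
     in each coordinate. *)
  pose F : set_system cantor :=
    [set B | exists n, forall y : cantor, restr x n = restr y n -> B y].
  have FF : Filter F.
    split; first by exists 0%N.
      move=> P Q [n nP] [m mQ]; exists (maxn n m) => y e; split.
        by apply: nP; apply: restr_le e; rewrite leq_maxl.
      by apply: mQ; apply: restr_le e; rewrite leq_maxr.
    by move=> P Q PQ [n nP]; exists n => y /nP /PQ.
  suff : F --> x by apply.
  apply/(@pointwise_cvgP nat bool F) => i B /nbhs_singleton Bxi.
  exists i.+1 => y /restrP e; by rewrite /= -e.
case=> n H.
have coord i : \forall y \near x, y i = x i.
  have /(_ _ [set x i]) := (@pointwise_cvgP nat bool (nbhs x) x _).1 cvg_id i.
  by apply; exact: discrete_set1.
suff : \forall y \near x, restr x n = restr y n.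
  by apply: filterS => y; exact: H.
elim: n {H} => [|k IH]; first by apply: filterS (coord 0%N).
by apply: filterS2 IH (coord k) => y e1 e2; rewrite !restrS e1 e2.
Qed.

Lemma open_cantorP (A : set cantor) :
  open A <-> forall x, A x ->
    exists n, forall y : cantor, restr x n = restr y n -> A y.
Proof.
rewrite openE; split=> oA x /oA; first by move/nbhs_cantorP.
by move=> h; apply/nbhs_cantorP.
Qed.

Lemma determined_open n (A : set cantor) : determined n A -> open A.
Proof. by move=> dA; apply/open_cantorP => x Ax; exists n => y /dA; apply. Qed.

Lemma determined_closed n (A : set cantor) : determined n A -> closed A.
Proof.
by move=> dA; rewrite -[A]setCK; apply: open_closedC;
  apply: (@determined_open n); apply: determinedC.
Qed.

(** * Stretches and closed offspring *)

(* The length of the stretch of a sequence of length [n]. *)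
Notation tri n := 'C(n.+1, 2).

Lemma triS n : tri n.+1 = (tri n + n.+1)%N.
Proof. by rewrite binS bin1. Qed.

Lemma tri_ge n : (n <= tri n)%N.
Proof. by elim: n => // n IH; rewrite triS addnS ltnS leq_addl. Qed.

Lemma leq_tri n m : (n <= m)%N -> (tri n <= tri m)%N.
Proof. by move=> nm; apply: leq_bin2l. Qed.

Definition cshift n (y : cantor) : cantor := fun k => y (n + k)%N.

Lemma restrD (y : cantor) n m : restr y (n + m) = restr y n ++ restr (cshift n y) m.
Proof. by rewrite /restr /mkseq iotaD map_cat -{2}[n]addn0 add0n iotaDl -map_comp. Qed.

Lemma restr_catinf s (w : cantor) : restr (catinf s w) (size s) = s.
Proof.
apply: (@eq_from_nth _ false); rewrite size_restr// => i ilt.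
by rewrite nth_restr// /catinf ilt.
Qed.

Lemma shift_catinf s (w : cantor) : cshift (size s) (catinf s w) = w.
Proof.
by apply/funext => k; rewrite /cshift /catinf ltnNge leq_addr/= addKn.
Qed.

Lemma catinf_shift (y : cantor) n : catinf (restr y n) (cshift n y) = y.
Proof.
apply/funext => k; rewrite /catinf size_restr; case: ltnP => h.
  exact: nth_restr.
by rewrite /cshift subnKC.
Qed.

Lemma stretch_rcons t b : stretch (rcons t b) = stretch t ++ nseq (size t).+1 b.
Proof.
rewrite /stretch size_rcons -addn1 iotaD map_cat flatten_cat /= cats0 add0n.
rewrite nth_rcons ltnn eqxx addn1; congr (flatten _ ++ _).
by apply/eq_in_map => j; rewrite mem_iota add0n /= nth_rcons => ->.
Qed.

Lemma size_stretch t : size (stretch t) = tri (size t).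
Proof.
by elim/last_ind: t => // t b IH; rewrite stretch_rcons size_cat IH size_nseq size_rcons triS.
Qed.

Lemma restr_stretch_inf (x : cantor) n :
  restr (stretch_inf x) (tri n) = stretch (restr x n).
Proof.
(* Prolonging a prefix leaves the entries of its stretch unchanged. The prefixes of lengths [n] and
   [k.+1] are compared below through their common prolongation of length [k.+1 + n]. *)
have stable m k p : (k < tri m)%N ->
    nth false (stretch (restr x (m + p))) k = nth false (stretch (restr x m)) k.
  move=> km; elim: p => [|p IH]; first by rewrite addn0.
  rewrite addnS restrS stretch_rcons nth_cat size_stretch size_restr IH ifT//.
  exact: leq_trans km (leq_tri (leq_addr _ _)).
apply: (@eq_from_nth _ false); rewrite size_restr ?size_stretch ?size_restr// => k kn.
rewrite nth_restr// /stretch_inf -(stable _ _ n) ?tri_ge//.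
by rewrite addnC stable.
Qed.

(* Position [tri i] starts the block of [y] that would repeat the [i]-th entry of
   [x] if [y] were the stretch of [x]. *)
Definition sample (y : cantor) : cantor := fun i => y (tri i).

(** The first [n] blocks of [y], of lengths 1 to [n], are constant. *)
Definition stretched n (y : cantor) :=
  restr y (tri n) = stretch (restr (sample y) n).

Lemma restr_sample (y : cantor) t :
  restr y (tri (size t)) = stretch t -> restr (sample y) (size t) = t.
Proof.
elim/last_ind: t => // t b IH.
rewrite size_rcons triS restrD stretch_rcons => /eqP.
rewrite eqseq_cat ?size_restr ?size_stretch// => /andP[/eqP /IH e /eqP e'].
rewrite restrS e; congr rcons.
by have := congr1 (nth false ^~ 0%N) e'; rewrite nth_restr// /cshift addn0.
Qed.

Lemma stretchedP (y : cantor) t :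
  restr y (tri (size t)) = stretch t -> stretched (size t) y.
Proof. by rewrite /stretched => h; rewrite restr_sample. Qed.

Lemma stretched_le n m (y : cantor) : (n <= m)%N -> stretched m y -> stretched n y.
Proof.
move=> nm; elim: m nm => [|m IH]; first by rewrite leqn0 => /eqP->.
rewrite leq_eqVlt => /predU1P[->//|/IH {}IH] h; apply: IH.
move: h; rewrite /stretched triS restrD (restrS (sample y)) stretch_rcons => /eqP.
by rewrite eqseq_cat ?size_stretch ?size_restr// => /andP[/eqP].
Qed.

Lemma stretched_stretch_inf n (x : cantor) : stretched n (stretch_inf x).
Proof.
by rewrite -{1}(size_restr x n); apply: stretchedP; rewrite size_restr restr_stretch_inf.
Qed.

Lemma sample_stretch_inf (x : cantor) n :
  restr (sample (stretch_inf x)) n = restr x n.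
Proof.
by rewrite -{1}(size_restr x n); apply: restr_sample; rewrite size_restr restr_stretch_inf.
Qed.

Lemma stretched_all (y : cantor) :
  (forall n, stretched n y) -> y = stretch_inf (sample y).
Proof.
move=> h; apply/funext => k; apply: (restrP _ _ (tri k.+1)).1; last exact: tri_ge.
by rewrite restr_stretch_inf -h.
Qed.

(** The node can be read off the point: [size t] is the number of constant blocks before the first
    nonconstant one, and [t] lists their values. *)
Lemma flat_Nbas t a (y : cantor) : Fl (size t) a -> Nbas (stretch t ++ a) y ->
  [/\ stretched (size t) y, restr (sample y) (size t) = t & ~ stretched (size t).+1 y].
Proof.
move=> [sa [na0 na1]]; rewrite /Nbas /= size_cat size_stretch sa -triS => e.
have et : restr y (tri (size t)) = stretch t.
  move/(congr1 (take (tri (size t)))): e; rewrite take_restr ?triS ?leq_addr//.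
  by rewrite take_size_cat ?size_stretch.
have es := restr_sample et; split=> //; first exact: stretchedP.
rewrite /stretched e restrS stretch_rcons es => /eqP.
rewrite eqseq_cat// eqxx /= => /eqP.
by case: (sample y _).
Qed.

Lemma nonconstant_block (y : cantor) n : stretched n y ->
  ~ stretched n.+1 y -> Fl n (restr (cshift (tri n) y) n.+1).
Proof.
move=> sn nsn; split; first exact: size_restr.
have key b : restr (cshift (tri n) y) n.+1 <> nseq n.+1 b.
  move=> e; apply: nsn; rewrite /stretched triS restrD (restrS (sample y)) stretch_rcons sn.
  rewrite size_restr e /sample.
  by have := congr1 (nth false ^~ 0%N) e; rewrite nth_restr// /cshift addn0 => ->.
by split; exact: key.
Qed.

(** * Membership in the closed offspring, level by level *)

Section OffspringCriterion.
Variables (T : set (seq bool)) (D : seq bool -> set cantor).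
Hypothesis T_take : forall t n, T t -> T (take n t).
Hypothesis D_closed : forall t, closed (D t).

(* Closedness and continuity come from rewriting membership in the offspring as a
   conjunction over [n] of conditions on a finite part of [y] and of the tree. *)
Definition level_ok (S : set (seq bool)) n (y : cantor) :=
  stretched n y -> S (restr (sample y) n) /\
    (~ stretched n.+1 y -> D (restr (sample y) n) (cshift (tri n.+1) y)).

Lemma offspring_flat t a (y : cantor) : T t -> Fl (size t) a ->
  Nbas (stretch t ++ a) y -> D t (cshift (tri (size t).+1) y) ->
  closed_offspring T D y.
Proof.
move=> Tt ta ya Dy; right; exists t, a, (cshift (tri (size t).+1) y); split=> //.
  exact: subset_closure.
case: ta => sa _; rewrite -ya size_cat size_stretch sa -triS.
by rewrite catinf_shift.
Qed.

Lemma closed_offspringE :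
  closed_offspring T D = [set y | forall n, level_ok T n y].
Proof.
apply/seteqP; split=> [_ [[x xT <-]|[t [a [w [Tt ta tw ->]]]]]|y yok].
- move=> n _; split; first by rewrite sample_stretch_inf.
  by case; exact: stretched_stretch_inf.
- set y := catinf _ _.
  have ya : Nbas (stretch t ++ a) y by exact: restr_catinf.
  have [st et nst] := flat_Nbas ta ya => n sn.
  have nt : (n <= size t)%N.
    by rewrite leqNgt; apply/negP => /stretched_le /(_ sn).
  split; first by rewrite -(take_restr _ nt) et; exact: T_take.
  move=> nsn; have -> : n = size t.
    apply/eqP; rewrite eqn_leq nt leqNgt; apply/negP => /stretched_le /(_ st).
    exact: nsn.
  rewrite et triS; case: ta => sa _.
  rewrite -size_stretch -sa -size_cat shift_catinf.
  by rewrite -(closure_id _).1 in tw.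
have [all_st|/existsNP ex_nst] := pselect (forall n, stretched n y).
  left; exists (sample y); last by rewrite -stretched_all.
  by move=> n; have [] := yok n (all_st n).
have ex : exists n, `[< ~ stretched n y >].
  by case: ex_nst => n h; exists n; apply/asboolP.
(* The first failing level is a successor [n.+1], as level 0 is vacuous; block [n] is then the first
   nonconstant one. *)
case: (ex_minnP ex) => -[|n] /asboolP nst minn; first by case: nst.
have st : stretched n y.
  by apply: contrapT => h; have := minn n (asboolT h); rewrite ltnn.
have [Tn /(_ nst) Dn] := yok n st.
apply: (@offspring_flat (restr (sample y) n) (restr (cshift (tri n) y) n.+1)) => //.
- by rewrite size_restr; exact: nonconstant_block.
- rewrite /Nbas /= size_cat size_stretch !size_restr restrD; congr (_ ++ _).
  exact: st.
- by rewrite size_restr.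
Qed.

End OffspringCriterion.

Lemma restr_shift k d (y z : cantor) :
  restr y (k + d) = restr z (k + d) -> restr (cshift k y) d = restr (cshift k z) d.
Proof. by move/restrP => e; apply/restrP => i id; apply: e; rewrite ltn_add2l. Qed.

Lemma restr_sample_eq n (y z : cantor) :
  restr y (tri n) = restr z (tri n) -> restr (sample y) n = restr (sample z) n.
Proof.
move/restrP => e; apply/restrP => i ilt; apply: e.
by apply: leq_trans (leq_tri ilt); rewrite triS addnS ltnS leq_addr.
Qed.

Lemma stretched_eq n (y z : cantor) :
  restr y (tri n) = restr z (tri n) -> stretched n y -> stretched n z.
Proof. by move=> e; rewrite /stretched -e -(restr_sample_eq e). Qed.

(** * Compactness, and continuity in the tree *)

Section OffspringTopology.
Variables (D : seq bool -> set cantor) (depth : seq bool -> nat).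
Hypothesis D_det : forall t, determined (depth t) (D t).
Hypothesis D_neq0 : forall t, D t !=set0.

(** The condition at level [n] inspects the blocks up to block [n], which end at [tri n.+1], and
    then as many coordinates as the set at the sampled node requires. *)
Lemma level_ok_eq T n (y z : cantor) :
  let N := (tri n.+1 + depth (restr (sample y) n))%N in
  restr y N = restr z N -> level_ok D T n z -> level_ok D T n y.
Proof.
move=> N e; have e1 : restr y (tri n.+1) = restr z (tri n.+1).
  by apply: restr_le e; rewrite leq_addr.
have e0 : restr y (tri n) = restr z (tri n).
  by apply: restr_le e1; rewrite leq_tri.
have es := restr_sample_eq e0.
move=> okz /(stretched_eq e0) /okz[Tz Dz]; split; first by rewrite es.
move=> nst; apply: (D_det (x := cshift (tri n.+1) z)).
  exact/esym/restr_shift.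
rewrite es; apply: Dz => sz; apply: nst; exact: stretched_eq (esym e1) sz.
Qed.

Lemma closed_level_ok T n : closed [set y | level_ok D T n y].
Proof.
rewrite -[X in closed X]setCK; apply: open_closedC; apply/open_cantorP => y nok.
exists (tri n.+1 + depth (restr (sample y) n))%N => z e okz.
exact/nok/(level_ok_eq e okz).
Qed.

Let D_closed t : closed (D t).
Proof. exact: determined_closed (@D_det t). Qed.

Lemma compact_closed_offspring T : (forall t n, T t -> T (take n t)) ->
  compact (closed_offspring T D).
Proof.
move=> Ttake; apply: (@subclosed_compact _ _ setT) => //; last exact: cantor_space_compact.
rewrite (closed_offspringE Ttake D_closed).
have -> : [set y | forall n, level_ok D T n y] =
    \bigcap_n [set y | level_ok D T n y].
  by apply/seteqP; split=> y h n; [move=> _; exact: h|exact: (h n Logic.I)].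
by apply: closed_bigI => n _; exact: closed_level_ok.
Qed.

Lemma continuous_closed_offspring :
  continuous_PrTr_K (fun T => closed_offspring T D).
Proof.
move=> T [_ Ttake _] V [U oU [->|->]] /=.
  rewrite (closed_offspringE Ttake D_closed) => FU.
  (* Upper half: [U] and the complements of the closed level conditions cover the Cantor space, so
     finitely many levels already force a point into [U]. *)
  have := cantor_space_compact; rewrite compact_cover.
  move=> /(_ nat setT (fun n => U `|` ~` [set y | level_ok D T n y])) [].
  - by move=> n _; apply: openU => //; apply: closed_openC; exact: closed_level_ok.
  - move=> y _; have [Uy|nUy] := pselect (U y); first by exists 0%N => //; left.
    have /existsNP[n nok] : ~ forall n, level_ok D T n y by move/FU.
    by exists n => //; right.
  move=> I _ cov.
  (* At level [n] the tree enters only through its nodes of length [n], so agreement on all words of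
     the selected lengths suffices. *)
  exists (flatten [seq words n | n <- finmap.enum_fset I]) => T' [_ Ttake' _] eqT.
  rewrite (closed_offspringE Ttake' D_closed) => y yok.
  have [n nI [//|nok]] := cov y Logic.I.
  case: nok => sn; have [T'n Dn] := yok n sn; split=> //; apply/eqT => //.
  apply/flattenP; exists (words n); last by rewrite mem_words size_restr.
  by apply/mapP; exists n.
(* Lower half: a point [y] of the offspring in [U] must survive in, or be replaced in, the offspring
   of nearby trees. If [y] lies in a piece at [t], the node [t] alone secures it. *)
move=> [y [Fy Uy]].
have [M yM] := (open_cantorP U).1 oU y Uy.
case: Fy => [[x xT xy]|[t [a [w [Tt ta tw ye]]]]]; last first.
  exists [:: t] => T' _ eqT; exists y; split=> //; right; exists t, a, w; split=> //.
  by apply/(eqT t) => //; rewrite inE.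
(* A point on a stretched branch is replaced by one in a piece hung at a long node of that branch.
   Length [M.+1] rather than [M], because [Fl 0] is empty. *)
exists [:: restr x M.+1] => T' _ eqT.
have Tx : T' (restr x M.+1) by apply/eqT; rewrite ?inE.
have [w Dw] := D_neq0 (restr x M.+1).
pose a := rcons (nseq M.+1 false) true.
exists (catinf (stretch (restr x M.+1) ++ a) w); split.
  right; exists (restr x M.+1), a, w; split=> //; last exact: subset_closure.
  rewrite size_restr; split; first by rewrite size_rcons size_nseq.
  split; rewrite /a.
    move/(congr1 (nth false ^~ M.+1)).
    by rewrite nth_rcons size_nseq ltnn eqxx nth_nseq ltnSn.
  by move/(congr1 (nth false ^~ 0%N)).
apply: yM; rewrite -xy.
have Mtri := leq_trans (leqnSn M) (tri_ge M.+1).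
apply: (restr_le Mtri); rewrite restr_stretch_inf.
have -> : tri M.+1 = size (stretch (restr x M.+1)) by rewrite size_stretch size_restr.
by apply/esym; apply: Nbas_prefix (prefix_prefix _ a) _; exact: restr_catinf.
Qed.
End OffspringTopology.

(** * Densities along stretched branches *)

Section OffspringDensity.
Variable R : realType.

(** Both sides are means over the words of length [n], and at each word the two relative measures
    are both 1 or both 0. *)
Lemma rho_shift n v (A B : set cantor) : determined n B ->
  (forall y, Nbas v y -> (A y <-> B (cshift (size v) y))) ->
  rho R A v = rho R B [::].
Proof.
move=> dB AB; rewrite (rho_words _ _ n) [RHS](rho_words _ _ n) big_seq [in RHS]big_seq.
congr (_ / _); apply: eq_bigr => s; rewrite mem_words => /eqP sn.
have [[x [xs Bx]]|nB] := pselect (exists x, Nbas s x /\ B x).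
  have Bs y : Nbas s y -> B y by move=> ys; apply: dB Bx; rewrite -sn xs ys.
  by rewrite !rho1//= => y /Nbas_catP[vy sy]; apply/AB => //; exact: Bs.
rewrite !rho0//; apply/seteqP; split=> y //= [].
  by move=> By sy; apply: nB; exists y.
by move=> Ay /Nbas_catP[vy sy]; apply: nB; exists (cshift (size v) y); split=> //; apply/AB.
Qed.

Variables (T : set (seq bool)) (D : seq bool -> set cantor) (depth : seq bool -> nat).
Hypothesis T_take : forall t n, T t -> T (take n t).
Hypothesis D_det : forall t, determined (depth t) (D t).
Let F := closed_offspring T D.
Let g t := rho R (D t) [::].

Lemma rho_flat t a : T t -> Fl (size t) a -> rho R F (stretch t ++ a) = g t.
Proof.
move=> Tt ta; have Dcl s : closed (D s) by exact: determined_closed (@D_det s).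
apply: (rho_shift (@D_det t)) => y ya.
have -> : size (stretch t ++ a) = tri (size t).+1.
  by case: ta => sa _; rewrite size_cat size_stretch sa triS.
split=> [|Dy]; last exact: offspring_flat ya Dy.
have [st et nst] := flat_Nbas ta ya.
by rewrite /F (closed_offspringE T_take Dcl) => /(_ _ st)[_ /(_ nst)]; rewrite et.
Qed.

(** Every completion of [a] to a full block is nonconstant and carries a copy of [D t]; averaging
    propagates the value [g t] back to [a]. *)
Lemma rho_nonconstant t a : T t -> (size a <= (size t).+1)%N ->
  false \in a -> true \in a -> rho R F (stretch t ++ a) = g t.
Proof.
move=> Tt; have [d] := ubnP ((size t).+1 - size a); elim: d a => // d IH a.
rewrite ltnS => ad sa a0 a1; have [sa'|sa'] := leqP (size t).+1 (size a).
  have {}sa : size a = (size t).+1 by apply/eqP; rewrite eqn_leq sa sa'.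
  apply: rho_flat => //; split=> //; split=> e.
    by move: a1; rewrite e mem_nseq.
  by move: a0; rewrite e mem_nseq.
rewrite rho_split !rcons_cat !IH ?size_rcons ?mem_rcons ?inE ?a0 ?a1 ?orbT//; last 2 first.
- by rewrite subnS -ltnS prednK ?subn_gt0// (leq_trans _ ad)// ltnS.
- by rewrite subnS -ltnS prednK ?subn_gt0// (leq_trans _ ad)// ltnS.
by field.
Qed.

(** Since [0 < j], the child that breaks the constant block already contains both values and has
    relative measure [g t]. Hence each step back from the end of the block halves the deviation from
    [g t]. *)
Lemma rho_constant t b d j : T t -> (0 < j)%N -> (j + d)%N = (size t).+1 ->
  rho R F (stretch t ++ nseq j b) - g t =
  2 ^- d * (rho R F (stretch (rcons t b)) - g t).
Proof.
move=> Tt; elim: d j => [|d IH] j j0.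
  by rewrite addn0 => ->; rewrite stretch_rcons expr0 invr1 mul1r.
rewrite addnS => jd; rewrite exprS invfM -mulrA -(IH j.+1)// rho_split !rcons_cat.
have nb : rho R F (stretch t ++ rcons (nseq j b) (~~ b)) = g t.
  apply: rho_nonconstant => //.
  - by rewrite size_rcons size_nseq -jd ltnS leq_addr.
  - by rewrite mem_rcons inE mem_nseq j0; case: (b).
  - by rewrite mem_rcons inE mem_nseq j0; case: (b).
have -> : nseq j.+1 b = rcons (nseq j b) b by rewrite -addn1 nseqD cats1.
by case: (b) nb => /= ->; field.
Qed.

(** After the first letter of the block, [size t] letters remain, so a deviation of at most 1 at the
    end of the block is scaled by [2 ^- size t]. *)
Lemma rho_stretch t : T t -> `|rho R F (stretch t) - g t| <= 2 ^- size t.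
Proof.
move=> Tt; have e b : `|rho R F (stretch t ++ [:: b]) - g t| <= 2 ^- size t.
  rewrite (@rho_constant t b (size t) 1)// normrM ger0_norm ?invr_ge0 ?exprn_ge0//.
  rewrite ler_piMr ?invr_ge0 ?exprn_ge0// ler_norml.
  have := rho_ge0 R F (stretch (rcons t b)); have := rho_le1 R F (stretch (rcons t b)).
  by have := rho_ge0 R (D t) [::]; have := rho_le1 R (D t) [::]; rewrite /g; lra.
rewrite rho_split -!cats1; have := e false; have := e true.
by rewrite !ler_norml => /andP[? ?] /andP[? ?]; lra.
Qed.

Variable x : cantor.
Hypothesis xT : branches T x.
Let u := dratio R F (stretch_inf x).

Lemma dratio_tri n : `|u (tri n) - g (restr x n)| <= 2 ^- n.
Proof.
by rewrite /u dratioE restr_stretch_inf; have := rho_stretch (xT n); rewrite size_restr.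
Qed.

Lemma dratio_between n j : (0 < j <= n.+1)%N -> exists2 q : R, 0 <= q <= 1 &
  u (tri n + j)%N = (1 - q) * g (restr x n) + q * u (tri n.+1).
Proof.
case/andP=> j0 jn; exists (2 ^- (n.+1 - j)).
  rewrite invr_ge0 exprn_ge0//= invf_le1 ?exprn_gt0// exprn_ege1// ler1n//.
rewrite /u !dratioE !restr_stretch_inf.
have -> : restr (stretch_inf x) (tri n + j) = stretch (restr x n) ++ nseq j (x n).
  have : (tri n + j <= tri n.+1)%N by rewrite triS leq_add2l.
  move=> /take_restr <-; rewrite restr_stretch_inf restrS stretch_rcons.
  by rewrite take_cat size_stretch size_restr ifN ?addKn ?take_nseq// -leqNgt leq_addr.
have := @rho_constant (restr x n) (x n) (n.+1 - j) j (xT n) j0.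
rewrite size_restr subnKC// -restrS => /(_ erefl) => h.
by rewrite -[LHS](subrK (g (restr x n))) h; ring.
Qed.

Lemma tri_decomp k : exists n j, (j <= n)%N /\ k = (tri n + j)%N.
Proof.
elim: k => [|k [n [j [jn ->]]]]; first by exists 0%N, 0%N.
have [jn'|jn'] := ltnP j n; first by exists n, j.+1; rewrite addnS.
by exists n.+1, 0%N; rewrite addn0 triS -addnS; split=> //;
  congr (_ + _.+1)%N; apply/eqP; rewrite eqn_leq jn jn'.
Qed.

Lemma density_is_branch (l : R) :
  g (restr x n) @[n --> \oo] --> l -> density_is F (stretch_inf x) l.
Proof.
move=> /cvgrPdist_lt gl; apply/cvgrPdist_lt => e e0.
have e2 : 0 < e / 2 by rewrite divr_gt0.
have [K Ke] := half_expn_lt e2.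
have [N _ NP] := gl _ e2.
have gN n : (maxn N K <= n)%N -> `|l - g (restr x n)| < e /\ `|l - u (tri n)| < e.
  rewrite geq_max => /andP[Nn Kn]; have := NP n Nn; have := dratio_tri n.
  have : 2 ^- n <= 2 ^- K :> R by rewrite lef_pV2 ?posrE ?exprn_gt0// ler_eXn2l// ltr1n.
  rewrite /= => h1 h2 h3; split; first lra.
  apply: le_lt_trans (ler_distD (g (restr x n)) _ _) _.
  by rewrite [X in _ + X]distrC; lra.
exists (tri (maxn N K)) => // k /= Nk.
have [n [j [jn kE]]] := tri_decomp k.
(* Otherwise the whole block [n] would end before [k], contradicting [j <= n]. *)
have Nn : (maxn N K <= n)%N.
  rewrite leqNgt; apply/negP => /leq_tri; rewrite triS => h.
  by have := leq_trans h Nk; rewrite kE leq_add2l ltnNge jn.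
rewrite -/u kE; have [h1 h2] := gN n Nn.
case: j jn {kE} => [|j] jn; first by rewrite addn0.
have [_ h3] := gN n.+1 (leq_trans Nn (leqnSn n)).
have [|q /andP[q0 q1] ->] := @dratio_between n j.+1; first by rewrite /= ltnW.
(* A convex combination of [G] and [V] is no farther from [l] than the worse of the two. *)
set G := g _ in h1 *; set V := u _ in h3 *; pose m := Num.max `|l - G| `|l - V|.
apply: (@le_lt_trans _ _ m); last by rewrite gt_max h1 h3.
have : `|l - G| <= m by rewrite le_max lexx.
have : `|l - V| <= m by rewrite le_max lexx orbT.
move: m => m; rewrite !ler_norml => /andP[a1 a2] /andP[b1 b2]; apply/andP; split; nra.
Qed.

Lemma dratio_itv n : 0 <= u n <= 1.
Proof. by rewrite /u dratioE rho_ge0 rho_le1. Qed.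

Lemma oscillation_gt0 (a b : R) : a < b ->
  (forall n, exists2 m, (n <= m)%N & g (restr x m) <= a) ->
  (forall n, exists2 m, (n <= m)%N & b <= g (restr x m)) ->
  0 < oscillation R F (stretch_inf x).
Proof.
move=> ab freq_a freq_b; rewrite subr_gt0 -/u.
(* Boundedness allows the limits superior and inferior to be computed as an infimum of suprema and a
   supremum of infima. *)
have bu : bounded_fun u.
  exists 1; split; first exact: num_real.
  by move=> y y1 n _ /=; have /andP[? ?] := dratio_itv n; rewrite ger0_norm// (le_trans _ (ltW y1)).
(* An error of a third of the gap on either side leaves the middle third between the two limits. *)
have d0 : 0 < (b - a) / 3 by rewrite divr_gt0// subr_gt0.
have [K Ke] := half_expn_lt d0.
have close n : (K <= n)%N -> `|u (tri n) - g (restr x n)| < (b - a) / 3.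
  move=> Kn; apply: le_lt_trans (dratio_tri n) (le_lt_trans _ Ke).
  by rewrite lef_pV2 ?posrE ?exprn_gt0// ler_eXn2l// ltr1n.
have lub n : has_ubound [set u k | k in [set k | (n <= k)%N]].
  by exists 1 => _ [k _ <-]; case/andP: (dratio_itv k).
have llb n : has_lbound [set u k | k in [set k | (n <= k)%N]].
  by exists 0 => _ [k _ <-]; case/andP: (dratio_itv k).
apply: (@le_lt_trans _ _ (a + (b - a) / 3)).
  rewrite limn_infE//; apply: ge_sup; first by exists (infs u 0%N); exists 0%N.
  move=> _ [n _ <-]; have [m nm gm] := freq_a (maxn n K).
  move: nm; rewrite geq_max => /andP[nm Km].
  apply: (@le_trans _ _ (u (tri m))).
    by apply: ge_inf; [exact: llb | exists (tri m) => //=; exact: leq_trans nm (tri_ge m)].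
  by have := close m Km; rewrite ltr_norml => /andP[]; lra.
apply: (@lt_le_trans _ _ (b - (b - a) / 3)); first by lra.
rewrite limn_supE//; apply: lb_le_inf; first by exists (sups u 0%N); exists 0%N.
move=> _ [n _ <-]; have [m nm gm] := freq_b (maxn n K).
move: nm; rewrite geq_max => /andP[nm Km].
apply: (@le_trans _ _ (u (tri m))).
  by have := close m Km; rewrite ltr_norml => /andP[]; lra.
by apply: ub_le_sup; [exact: lub | exists (tri m) => //=; exact: leq_trans nm (tri_ge m)].
Qed.

End OffspringDensity.

(** * The compliant family *)

(* One more than the position of the last [true] of [t], or [0] if there is none. *)
Definition last_one (t : seq bool) : nat := (size t - find id (rev t))%N.

Lemma last_one_rcons t b :
  last_one (rcons t b) = if b then (size t).+1 else last_one t.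
Proof. by rewrite /last_one size_rcons rev_rcons /=; case: b. Qed.

Lemma last_one_le t : (last_one t <= size t)%N.
Proof. exact: leq_subr. Qed.

Lemma last_one_gt (x : cantor) i n :
  (i < n)%N -> x i -> (i < last_one (restr x n))%N.
Proof.
elim: n => // n IH; rewrite ltnS restrS last_one_rcons size_restr.
case: ifP => // xn; rewrite leq_eqVlt => /predU1P[->|]; first by rewrite xn.
exact: IH.
Qed.

Lemma last_one_stable (x : cantor) N n : (forall i, (N <= i)%N -> ~ x i) ->
  (N <= n)%N -> last_one (restr x n) = last_one (restr x N).
Proof.
move=> xN; elim: n => [|n IH]; first by rewrite leqn0 => /eqP->.
rewrite leq_eqVlt => /predU1P[->//|Nn]; rewrite restrS last_one_rcons.
by case: ifP => [/(xN _ Nn)//|_]; exact: IH.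
Qed.

(** The tail of ones keeps the point in [Ninf], where [c] is controlled; cutting at the last one
    makes it insensitive to zeros appended to [t]. *)
Definition basepoint (t : seq bool) : cantor :=
  catinf (take (last_one t) t) (fun=> true).

Lemma Ninf_basepoint t : Ninf (basepoint t).
Proof.
move=> m; exists (size (take (last_one t) t) + m)%N; first exact: leq_addl.
by rewrite /basepoint /catinf ltnNge leq_addr.
Qed.

Lemma restr_basepoint (x : cantor) n :
  restr (basepoint (restr x n)) (last_one (restr x n)) = restr x (last_one (restr x n)).
Proof.
have le : (last_one (restr x n) <= n)%N.
  by rewrite -[X in (_ <= X)%N](size_restr x n) last_one_le.
rewrite /basepoint take_restr//.
by have := restr_catinf (restr x (last_one (restr x n))) (fun=> true); rewrite size_restr.
Qed.

Section Pieces.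
Variables (R : realType) (c : cantor -> R).
Hypothesis c01 : forall x, Ninf x -> 0 <= c x <= 1.

Lemma rho_take_words n k : (k <= 2 ^ n)%N ->
  rho R [set w | restr w n \in take k (words n)] [::] = k%:R / 2 ^+ n.
Proof.
move=> kn; rewrite (rho_words _ _ n); congr (_ / _).
set S := take k (words n).
(* [k] is written as a sum of indicators over all words; the words being distinct, those after the
   first [k] contribute zero. *)
have -> : k = (\sum_(s <- words n) (s \in S))%N.
  have sS : size S = k by rewrite size_takel ?size_words.
  rewrite -[in LHS]sS; have := uniq_words n; rewrite -(cat_take_drop k (words n)) -/S cat_uniq.
  case/and3P=> _ /hasPn dS _; rewrite big_cat /= [X in (_ + X)%N]big1_seq.
    rewrite addn0 big_seq -sum1_size [LHS]big_seq; by apply: eq_bigr => s ->.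
  by move=> s /= /dS /negPf ->.
rewrite natr_sum big_seq [RHS]big_seq; apply: eq_bigr => s; rewrite mem_words => /eqP sn.
case: (boolP (s \in S)) => sS.
  by rewrite rho1// => y; rewrite /Nbas /= sn => ->.
rewrite rho0//; apply/seteqP; split=> y //= [yS]; rewrite /Nbas /= sn => e.
by rewrite e (negPf sS) in yS.
Qed.

Definition depth t := (last_one t).+2.

(* The measure of [piece t] approximates [c (basepoint t)] up to
   [2 ^- last_one t]; the term [odd (size t)] makes it oscillate along a branch
   that is eventually [false]. *)
Definition numerator t : nat :=
  (Num.truncn (c (basepoint t) * (2 ^+ depth t - 3)) + 1 + odd (size t))%N.

Definition piece t : set cantor :=
  [set w | restr w (depth t) \in take (numerator t) (words (depth t))].

Lemma determined_piece t : determined (depth t) (piece t).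
Proof. by move=> x y; rewrite /piece /= => ->. Qed.

(** The truncation lies between 0 and [p - 3], so adding 1 and possibly 1 more stays strictly
    between 0 and [p]: the piece is neither null nor full. The two exponents added in [depth] give
    [p >= 4], so that [p - 3] is positive. *)
Lemma numerator_bounds t (p := 2 ^+ depth t : R) :
  [/\ 1 <= (numerator t)%:R :> R, (numerator t)%:R <= p - 1,
      c (basepoint t) * p - 3 <= (numerator t)%:R &
      (numerator t)%:R <= c (basepoint t) * p + 3].
Proof.
have /andP[c0 c1] := c01 (Ninf_basepoint t).
have p4 : 4 <= p.
  have : 1 <= 2 ^+ last_one t :> R by rewrite exprn_ege1// ler1n.
  by rewrite /p /depth !exprS; lra.
have y0 : 0 <= c (basepoint t) * (p - 3) by apply: mulr_ge0 => //; lra.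
have /andP[] := truncn_itv y0; rewrite -[X in _ < X]natr1 /numerator -/p !natrD.
set y := (Num.truncn _)%:R => y1 y2.
have o0 : 0 <= (odd (size t))%:R :> R by rewrite ler0n.
have o1 : (odd (size t))%:R <= 1 :> R by rewrite lern1 leq_b1.
have yge0 : 0 <= y by rewrite ler0n.
by split; nra.
Qed.

Lemma rho_piece t : rho R (piece t) [::] = (numerator t)%:R / 2 ^+ depth t.
Proof.
apply: rho_take_words; have [_ h _ _] := numerator_bounds t.
by rewrite -(ler_nat R) natrX (le_trans h)// gerDl oppr_le0.
Qed.

Lemma rho_piece_close t :
  `|c (basepoint t) - rho R (piece t) [::]| <= 2 ^- last_one t.
Proof.
have [_ _ h1 h2] := numerator_bounds t; rewrite rho_piece.
have p0 : 0 < 2 ^+ depth t :> R by rewrite exprn_gt0.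
(* [depth] exceeds [last_one] by 2, so the error [3 / 2 ^+ depth t] is below [2 ^- last_one t]. *)
have -> : 2 ^- last_one t = 4 / 2 ^+ depth t :> R.
  by rewrite /depth !exprS; field; rewrite expf_neq0.
have -> : c (basepoint t) - (numerator t)%:R / 2 ^+ depth t =
    (c (basepoint t) * 2 ^+ depth t - (numerator t)%:R) / 2 ^+ depth t.
  by rewrite mulrBl mulfK// gt_eqF.
rewrite normrM [X in _ * X]ger0_norm ?invr_ge0 ?(ltW p0)//.
by rewrite ler_pM2r ?invr_gt0// ler_norml; apply/andP; split; lra.
Qed.

Lemma rho_piece_gt0 t : 0 < rho R (piece t) [::].
Proof.
have [h _ _ _] := numerator_bounds t; rewrite rho_piece divr_gt0 ?exprn_gt0//.
exact: lt_le_trans h.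
Qed.

Lemma rho_piece_lt1 t : rho R (piece t) [::] < 1.
Proof.
have [_ h _ _] := numerator_bounds t; rewrite rho_piece.
by rewrite ltr_pdivrMr ?exprn_gt0// mul1r (le_lt_trans h)// gtrDl oppr_lt0.
Qed.

Lemma piece_neq0 t : piece t !=set0.
Proof.
apply/set0P/eqP => e; have := rho_piece_gt0 t.
by rewrite e rho0 ?set0I// ltxx.
Qed.

Lemma compliant_piece T : compliant R T piece.
Proof.
move=> t _; have det := @determined_piece t; split.
- exact: determined_dualistic det.
- exact/eqP/set0P/piece_neq0.
- by move=> e; have := rho_piece_lt1 t; rewrite e rho1 ?ltxx.
- rewrite (interior_id _).1; last exact: determined_open det.
  by rewrite -(closure_id _).1//; exact: determined_closed det.
Qed.

Lemma rho_piece_cvg (x : cantor) : {within Ninf, continuous c} -> Ninf x ->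
  rho R (piece (restr x n)) [::] @[n --> \oo] --> c x.
Proof.
move=> /subspace_continuousP cc xN; apply/cvgrPdist_lt => e e0.
have e2 : 0 < e / 2 by rewrite divr_gt0.
have [K Ke] := half_expn_lt e2.
have /cvgrPdist_lt/(_ _ e2) : c z @[z --> within Ninf (nbhs x)] --> c x by exact: cc.
move=> /nbhs_cantorP[M xM].
(* Once a one at a position beyond [M] and [K] has been read, the base point agrees with [x] up to
   [M] and the approximation error is at most [2 ^- K]. *)
have [i Mi xi] := xN (maxn M K); exists i.+1 => // n /= lt_in.
have := last_one_gt lt_in xi; set m := last_one _ => im.
have [Mm Km] : (M <= m)%N /\ (K <= m)%N.
  by apply/andP; rewrite -geq_max (leq_trans Mi)// ltnW.
have := xM (basepoint (restr x n)).
have -> : restr (basepoint (restr x n)) M = restr x M.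
  exact: restr_le Mm (restr_basepoint x n).
move=> /(_ erefl (@Ninf_basepoint _)) => h1.
apply: le_lt_trans (ler_distD (c (basepoint (restr x n))) _ _) _.
have h2 := rho_piece_close (restr x n).
have : 2 ^- m <= 2 ^- K :> R by rewrite lef_pV2 ?posrE ?exprn_gt0// ler_eXn2l// ltr1n.
by move: h2; rewrite -/m; lra.
Qed.

Lemma rho_piece_oscillates (x : cantor) : ~ Ninf x -> exists a b : R, [/\ a < b,
  (forall n, exists2 m, (n <= m)%N & rho R (piece (restr x m)) [::] <= a) &
  (forall n, exists2 m, (n <= m)%N & b <= rho R (piece (restr x m)) [::])].
Proof.
move=> /existsNP[N xN]; have {}xN i : (N <= i)%N -> ~ x i.
  by move=> Ni xi; apply: xN; exists i.
pose t := restr x N; pose p : R := 2 ^+ depth t.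
pose A := (Num.truncn (c (basepoint t) * (p - 3)) + 1)%N.
have p0 : 0 < p by rewrite exprn_gt0.
(* Past the last one of [x], the depth and the base point are frozen; only the parity of [n] still
   changes the measure, by one unit [1 / p]. *)
have E n : (N <= n)%N -> rho R (piece (restr x n)) [::] = (A + odd n)%:R / p.
  move=> Nn; rewrite rho_piece /numerator size_restr.
  have es := last_one_stable xN Nn; rewrite /depth /basepoint es.
  have Nt : (last_one (restr x N) <= N)%N.
    by rewrite -[X in (_ <= X)%N](size_restr x N) last_one_le.
  by rewrite take_restr ?(leq_trans Nt)// -(take_restr x Nt).
exists (A%:R / p), (A.+1%:R / p); split.
- by rewrite ltr_pM2r ?invr_gt0// ltr_nat.
- move=> n; exists (maxn N n).*2; first by rewrite -addnn (leq_trans (leq_maxr N n))// leq_addr.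
  by rewrite E ?odd_double ?addn0// -addnn (leq_trans (leq_maxl N n))// leq_addr.
- move=> n; exists (maxn N n).*2.+1.
    by rewrite -addnn (leq_trans (leq_maxr N n))// ltnW// ltnS leq_addr.
  rewrite E /= ?odd_double ?addn1// -addnn (leq_trans (leq_maxl N n))// ltnW// ltnS leq_addr//.
Qed.

End Pieces.

Theorem theorem4p1 (R : realType) (c : cantor -> R) :
  (forall x, Ninf x -> 0 <= c x <= 1) ->
  {within Ninf, continuous c} ->
  exists F : set (seq bool) -> set cantor,
    continuous_PrTr_K F /\
    forall T, pruned_tree T ->
      [/\ compact (F T),
          (exists D : seq bool -> set cantor,
              compliant R T D /\ F T = closed_offspring T D),
          (forall x, branches T x ->
              (Ninf x <-> oscillation R (F T) (stretch_inf x) = 0)) &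
          (forall x, branches T x -> Ninf x ->
              density_is (F T) (stretch_inf x) (c x))].
Proof.
move=> c01 cc; have det := @determined_piece R c.
exists (fun T => closed_offspring T (piece c)); split.
  by apply: continuous_closed_offspring det _; exact: piece_neq0.
move=> T [_ Ttake _].
have dens x : branches T x -> Ninf x ->
    density_is (closed_offspring T (piece c)) (stretch_inf x) (c x).
  by move=> xT xN; apply: (density_is_branch Ttake det xT); exact: rho_piece_cvg.
split=> //.
- exact: compact_closed_offspring det _ Ttake.
- by exists (piece c); split=> //; exact: compliant_piece.
move=> x xT; split=> [/(dens x xT) /cvg_limn_inf_sup[e1 e2]|osc0].
  by rewrite /oscillation e1 e2 subrr.
(* Conversely, with finitely many ones the measures of the pieces alternate between two values,
   which forces a positive oscillation. *)
apply: contrapT => /(rho_piece_oscillates c01)[a [b [ab ha hb]]].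
by have := oscillation_gt0 Ttake det xT ab ha hb; rewrite osc0 ltxx.
Qed.
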